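(* Let $I\subset S=K[x_1,\dots,x_n]$ be a monomial ideal with $|G(I)|=m$, where $m$ is odd. Suppose there exists a prime ideal $P\in\operatorname{Ass}(S/I)$ with $\operatorname{height}(P)\ge m-1$. Then $$\operatorname{sdepth}_S(I)=n-\left\lfloor\frac{m}{2}\right\rfloor.$$
   Context: $K$ is a field and $S=K[x_1,\dots,x_n]$ is the polynomial ring, with its standard $\mathbb{Z}^n$-grading. $G(I)$ denotes the set of minimal monomial generators of a monomial ideal $I$. Let $M$ be a finitely generated $\mathbb{Z}^n$-graded $S$-module. For a homogeneous $u\in M$ and a subset $Z\subset\{x_1,\dots,x_n\}$, $uK[Z]$ denotes the $K$-subspace of $M$ generated by all $uv$, $v$ a monomial in $K[Z]$; if $uK[Z]$ is a free $K[Z]$-module it is called a Stanley space of dimension $|Z|$. A Stanley decomposition of $M$ is a presentation of $M$ as a finite direct sum of $\mathbb{Z}^n$-graded $K$-vector spaces $\mathcal{D}: M=\bigoplus_{i=1}^{s}u_iK[Z_i]$ with each $u_iK[Z_i]$ a Stanley space; $\operatorname{sdepth}\mathcal{D}=\min_i|Z_i|$, and $\operatorname{sdepth}_S M$ is the maximum of $\operatorname{sdepth}\mathcal{D}$ over all Stanley decompositions $\mathcal{D}$ of $M$. *)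

(* Defs.v *)
From HB Require Import structures.
From mathcomp Require Import all_boot all_order all_algebra.
From mathcomp Require Import ring_quotient finmap mpoly.

Set Implicit Arguments.
Unset Strict Implicit.
Unset Printing Implicit Defensive.

Import GRing.Theory.
Local Open Scope ring_scope.
Local Open Scope fset_scope.

Section Ideals.
Variables (K : fieldType) (n : nat).
Local Notation S := {mpoly K[n]}.

Definition generates (A : {pred 'X_{1..n}}) (I : {pred S}) : Prop :=
  forall f : S, f \in I <->
    exists (s : seq 'X_{1..n}) (c : 'X_{1..n} -> S),
      {subset s <= A} /\ f = \sum_(a <- s) c a * 'X_[a].

Definition monomial_ideal (I : {pred S}) : Prop :=
  exists A : {pred 'X_{1..n}}, generates A I.

(* [G] is G(I), each monomial being given by its exponent vector. *)
Definition minimal_generators (G : {fset 'X_{1..n}}) (I : {pred S}) : Prop :=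
  generates (mem G) I /\
  forall G' : {fset 'X_{1..n}}, G' `<` G -> ~ generates (mem G') I.

(* [idealr_closed] includes that the ideal is proper. *)
Definition prime_ideal (P : {pred S}) : Prop :=
  idealr_closed P /\ prime_idealr_closed P.

(* P is in Ass(S/I): P is the annihilator of the class of some f. *)
Definition associated_prime (I P : {pred S}) : Prop :=
  prime_ideal P /\ exists f : S, forall g : S, g \in P <-> g * f \in I.

(* A chain Q 0 < Q 1 < ... < Q h = P of prime ideals; only the values Q i
   for i <= h matter. *)
Definition prime_chain (P : {pred S}) (h : nat) (Q : nat -> {pred S}) : Prop :=
  [/\ forall i, (i <= h)%N -> prime_ideal (Q i),
      forall i, (i < h)%N ->
        {subset Q i <= Q i.+1} /\ exists2 f, f \in Q i.+1 & f \notin Q i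
    & Q h =i P].

Definition has_height (P : {pred S}) (h : nat) : Prop :=
  (exists Q, prime_chain P h Q) /\
  (forall h' Q, prime_chain P h' Q -> (h' <= h)%N).

End Ideals.

Section StanleyDepth.
Variables (K : fieldType) (n : nat).
Local Notation S := {mpoly K[n]}.

(* p is in K[Z], Z being the set of the indices of its variables. *)
Definition in_vars (Z : {set 'I_n}) (p : S) : Prop :=
  forall a : 'X_{1..n}, a \in msupp p -> forall i : 'I_n, a i != 0%N -> i \in Z.

(* The Z^n-graded components of S are the lines K x^a, a in N^n. *)
Definition homogeneous (u : S) : Prop :=
  exists (c : K) (a : 'X_{1..n}), u = c *: 'X_[a].

(* f is in u K[Z]. *)
Definition in_span (u : S) (Z : {set 'I_n}) (f : S) : Prop :=
  exists2 p : S, in_vars Z p & f = u * p.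

(* u K[Z] is free over K[Z], with basis u (in particular u is nonzero). *)
Definition stanley_space (u : S) (Z : {set 'I_n}) : Prop :=
  homogeneous u /\ forall p : S, in_vars Z p -> u * p = 0 -> p = 0.

(* I is the internal direct sum of the Stanley spaces u_i K[Z_i]; the grading
   is respected automatically since the u_i are homogeneous. *)
Definition stanley_decomposition (I : {pred S}) (s : nat)
    (u : 'I_s -> S) (Z : 'I_s -> {set 'I_n}) : Prop :=
  [/\ forall i, stanley_space (u i) (Z i),
      forall f : S, f \in I <->
        exists2 g : 'I_s -> S, forall i, in_span (u i) (Z i) (g i)
                             & f = \sum_(i < s) g i
    & forall g : 'I_s -> S, (forall i, in_span (u i) (Z i) (g i)) ->
        \sum_(i < s) g i = 0 -> forall i, g i = 0].

(* min_i |Z_i|. As |Z_i| <= n, the default value n only matters for s = 0,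
   which occurs for the zero ideal alone. *)
Definition sdepth_dec (s : nat) (Z : 'I_s -> {set 'I_n}) : nat :=
  \big[minn/n]_(i < s) #|Z i|.

(* sdepth_S(I) = d, as a maximum: attained, and an upper bound. *)
Definition has_sdepth (I : {pred S}) (d : nat) : Prop :=
  (exists s (u : 'I_s -> S) (Z : 'I_s -> {set 'I_n}),
     stanley_decomposition I u Z /\ sdepth_dec Z = d) /\
  (forall s (u : 'I_s -> S) (Z : 'I_s -> {set 'I_n}),
     stanley_decomposition I u Z -> (sdepth_dec Z <= d)%N).

End StanleyDepth.

(* Main.v *)
Require Import Defs.
From mathcomp Require Import all_boot all_order all_algebra.
From mathcomp Require Import ring_quotient finmap mpoly zify.

(** The two inequalities have independent proofs.

    Lower bound.  Let g_1, .., g_m be the generators.  A monomial w of I is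
    classified by the set T(w) of the j such that g_j divides w, a nonempty
    subset of [m].  Suppose that the nonempty subsets of [m] are partitioned
    into intervals [X, Y] with |Y| > m/2.  The monomials w with T(w) in [X, Y]
    are the multiples of the lcm of the g_j, j in X, that avoid the m - |Y|
    generators g_j, j not in Y.  Avoiding one monomial costs at most one free
    variable (cone_minus), so these monomials form a disjoint union of cones
    with at least n - (m - |Y|) >= n - floor(m/2) free variables.

    For m odd such a partition has a closed form.  Regard [m] as the cycle
    Z/m and take for Y all the subsets that never miss two consecutive points,
    with X = Y :&: (Y + 1).  A set T lies in [X, Y] iff, for every y, y is in Y
    exactly when y is in T or y - 1 is not in Y (cyc_intervalP).  When T is
    nonempty this recursion has exactly one solution: the set of the points y
    whose distance back to T is even.  Counting gives |X| + m = 2 |Y|, whence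
    |Y| > m/2.

    Upper bound.  Write P = I : f.  As I is spanned by monomials, P is
    generated by the variables it contains, say those indexed by A, and for
    each N there is a monomial x^a with x_i x^a in I for i in A, but with x^a
    times the N-th powers of the other variables outside I
    (colon_prime_monom).  Take N larger than all the exponents of the apexes
    of the cones of a Stanley decomposition.  The cones through
    x^a x_i (prod_{k not in A} x_k)^N, i in A, are then free in all variables
    outside A; and if the cone of i is free in k and that of k is free in i,
    for i <> k in A, both contain the same monomial, hence coincide, which
    their apexes forbid.  So 'the cone of i is free in k' is an antisymmetric
    relation on A, some i has at most (|A| - 1)/2 out-neighbours, and the cone
    of i has dimension at most n - floor(|A|/2) (sdepth_dec_le_local).

    It remains to see that the height h of P is at most |A|.  A chain of h
    primes below P turns, one prime at a time, N^d elements that are linearly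
    independent modulo P into N^(d+h) elements that are linearly independent
    modulo the bottom prime, of degree O(N): multiply by the powers of an
    element of the larger prime outside the smaller one (free_mod_powers).
    Starting from the monomials in the n - |A| variables outside A, and since
    polynomials of degree O(N) form a space of dimension O(N^n), this gives
    n - |A| + h <= n (colon_prime_height). *)

Set Implicit Arguments.
Unset Strict Implicit.
Unset Printing Implicit Defensive.

Import GRing.Theory.
Local Open Scope ring_scope.

(** * An interval partition of the nonempty subsets of a cycle *)

Definition cyc_cover m (Y : {set 'I_m}) :=
  [forall y, (y \in Y) || (ord_pred y \in Y)].

(** This is Y :&: (Y + 1), since [ord_pred] is the cyclic predecessor. *)
Definition cyc_bottom m (Y : {set 'I_m}) := [set y in Y | ord_pred y \in Y].

(** Inclusion-exclusion for Y and its translate Y + 1, whose union is the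
    whole cycle. *)
Lemma card_cyc_bottom m (Y : {set 'I_m}) :
  cyc_cover Y -> (#|cyc_bottom Y| + m = #|Y|.*2)%N.
Proof.
move=> /forallP covY.
pose Y' := (@ord_pred m) @^-1: Y.
have cardY' : #|Y'| = #|Y|.
  rewrite card_preimset //; exact: can_inj (@ord_predK m).
have -> : cyc_bottom Y = Y :&: Y' by apply/setP=> y; rewrite !inE.
have UT : Y :|: Y' = setT by apply/setP=> y; rewrite !inE covY.
by have := cardsUI Y Y'; rewrite UT cardsT card_ord cardY' addnn addnC.
Qed.

(** Membership in the interval below Y becomes a recursion along the cycle,
    which determines Y from T. *)
Lemma cyc_intervalP m (Y T : {set 'I_m}) :
  reflect (forall y, (y \in Y) = (y \in T) || (ord_pred y \notin Y))
          [&& cyc_cover Y, cyc_bottom Y \subset T & T \subset Y].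
Proof.
apply: (iffP and3P) => [[/forallP covY /subsetP botT /subsetP TY] y | eqY].
  apply/idP/orP => [yY | [/TY // | yNY]]; last first.
    by have := covY y; rewrite (negPf yNY) orbF.
  case: (boolP (ord_pred y \in Y)) => [pY | _]; last by right.
  by left; apply: botT; rewrite inE yY.
split.
- by apply/forallP => y; rewrite eqY; case: (_ \in T) => //=; case: (_ \in Y).
- by apply/subsetP => y; rewrite inE eqY => /andP[/orP[] // /negPf ->].
- by apply/subsetP => y yT; rewrite eqY yT.
Qed.

Lemma cyc_ind m (P : 'I_m -> Prop) (t : 'I_m) :
  P t -> (forall y, P (ord_pred y) -> P y) -> forall y, P y.
Proof.
move=> Pt PS y.
have Pi k : P (iter k (@ordS m) t).
  by elim: k => //= k IH; apply: PS; rewrite ordSK.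
have iterE k : iter k (@ordS m) t = ((t + k) %% m)%N :> nat.
  elim: k => [|k IH] /=; first by rewrite addn0 modn_small.
  by rewrite IH -addn1 modnDml addn1 addnS.
suff -> : y = iter (y + m - t)%N (@ordS m) t by [].
apply: val_inj => /=; rewrite iterE subnKC; last by have := ltn_ord t; lia.
by rewrite modnDr modn_small.
Qed.

(** A point of T starts the recursion: there both sets contain the point. *)
Lemma cyc_interval_uniq m (Y1 Y2 T : {set 'I_m}) :
  T != set0 ->
  (forall y, (y \in Y1) = (y \in T) || (ord_pred y \notin Y1)) ->
  (forall y, (y \in Y2) = (y \in T) || (ord_pred y \notin Y2)) -> Y1 = Y2.
Proof.
move=> /set0Pn[t tT] eq1 eq2; apply/setP; apply: (cyc_ind (t := t)).
  by rewrite eq1 eq2 tT.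
by move=> y IH; rewrite eq1 eq2 IH.
Qed.

(** The solution is the set of the points at even distance after the last
    point of T. *)
Lemma cyc_interval_exists m (T : {set 'I_m}) :
  T != set0 ->
  exists Y : {set 'I_m}, forall y, (y \in Y) = (y \in T) || (ord_pred y \notin Y).
Proof.
move=> /set0Pn[t tT].
have back y : exists k, iter k (@ord_pred m) y \in T.
  move: y; apply: (cyc_ind (t := t)) => [|y [k kT]]; first by exists 0%N.
  by exists k.+1; rewrite iterSr.
pose dist y := ex_minn (back y).
have distE y : dist y = if y \in T then 0%N else (dist (ord_pred y)).+1.
  rewrite /dist; case: ex_minnP => k kT kmin; case: ifP => yT.
    by apply/eqP; rewrite -leqn0; apply: kmin.
  case: ex_minnP => j jT jmin; apply/eqP; rewrite eqn_leq kmin ?iterSr //.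
  case: k kT kmin => [|k] kT kmin; first by move: kT; rewrite /= yT.
  by apply: jmin; rewrite -iterSr.
exists [set y | ~~ odd (dist y)] => y; rewrite !inE distE.
by case: ifP => //= _; rewrite negbK.
Qed.

(** The intervals partition the nonempty sets.  The parity of m excludes the
    empty set: a bottom is never empty, because |bottom| + m is even. *)
Lemma count_cyc_interval m (T : {set 'I_m}) :
  odd m ->
  count (fun Y => (cyc_bottom Y \subset T) && (T \subset Y))
        [seq Y <- enum {set 'I_m} | cyc_cover Y] = (T != set0).
Proof.
move=> oddm; rewrite count_filter.
set p := predI _ _.
have pE Y : p Y = [&& cyc_cover Y, cyc_bottom Y \subset T & T \subset Y].
  by rewrite /p /= andbC.
have [/eqP T0 | T0] := boolP (T == set0).
  have -> : count p (enum {set 'I_m}) = count pred0 (enum {set 'I_m}).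
    apply: eq_count => Y; rewrite pE; apply/and3P => -[covY].
    rewrite T0 subset0 => /eqP bot0 _.
    by have := card_cyc_bottom covY; rewrite bot0 cards0; lia.
  exact: count_pred0.
have [Y okY] := cyc_interval_exists T0.
have -> : count p (enum {set 'I_m}) = count_mem Y (enum {set 'I_m}).
  apply: eq_count => Y'; rewrite pE /=; apply/cyc_intervalP/eqP => [okY' | -> //].
  exact: cyc_interval_uniq okY' okY.
by rewrite count_uniq_mem ?enum_uniq // mem_enum.
Qed.

(** * Cones of monomials *)

Local Notation cone n := ('X_{1..n} * {set 'I_n})%type.

Definition in_cone n (c : cone n) (w : 'X_{1..n}) : bool :=
  [forall i, (c.1 i <= w i)%N && ((i \in c.2) || (c.1 i == w i))].
Arguments in_cone {n} c w.

Lemma in_coneP n (a : 'X_{1..n}) (Z : {set 'I_n}) (w : 'X_{1..n}) :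
  reflect ((a <= w)%MM /\ forall i, i \notin Z -> a i = w i)
          (in_cone ((a, Z) : cone n) w).
Proof.
apply: (iffP forallP) => [aw | [/mnm_lepP aw awZ] i /=].
  split; first by apply/mnm_lepP => i; have /andP[] := aw i.
  by move=> i /negPf iZ; have /andP[_] := aw i; rewrite /= iZ => /eqP.
by rewrite aw /=; case: (boolP (i \in Z)) => //= /awZ ->.
Qed.

(** If a variable x_i, free in the cone x^a K[Z], has a smaller exponent in x^a
    than in x^v, split off the monomials with x_i-exponent a_i: none of them is
    a multiple of x^v, and only x_i has been lost.  What is left is the cone
    with apex x^a x_i, closer to x^v. *)
Lemma cone_minus n (a : 'X_{1..n}) (Z : {set 'I_n}) (v : 'X_{1..n}) :
  exists2 L : seq (cone n), all (fun c : cone n => #|Z| <= #|c.2|.+1)%N L &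
    forall w, count (in_cone^~ w) L = in_cone (a, Z) w && ~~ (v <= w)%MM :> nat.
Proof.
have [d] := ubnP (mdeg (v - a)%MM); elim: d => // d IHd in a *; rewrite ltnS => le_d.
have [va | ] := boolP (v <= a)%MM.
  exists [::] => // w /=; case: in_coneP => //= -[aw _].
  by rewrite (lepm_trans va aw).
have -> : (v <= a)%MM = [forall i, (v i <= a i)%N].
  by apply/mnm_lepP/forallP.
rewrite negb_forall => /existsP[i]; rewrite -ltnNge => av.
have [iZ | iZ] := boolP (i \in Z); last first.
  exists [:: (a, Z)] => [|w /=]; first by rewrite /= leqnSn.
  rewrite addn0; case: in_coneP => //= -[_ /(_ i iZ) aw].
  by case: mnm_lepP => // /(_ i); rewrite -aw leqNgt av.
have [|L dimL cntL] := IHd (a + U_(i))%MM.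
  apply: leq_trans le_d; rewrite !mdegE (bigD1 i) //= [ltnRHS](bigD1 i) //=.
  rewrite -addSn leq_add //.
    by rewrite !mnmBE mnmDE mnm1E eqxx; lia.
  by apply: leq_sum => j _; rewrite !mnmBE mnmDE; lia.
exists ((a, Z :\ i) :: L); first by rewrite /= dimL (cardsD1 i) iZ leqnn.
move=> w /=; rewrite cntL.
have split_i : in_cone (a, Z) w =
    in_cone (a, Z :\ i) w || in_cone ((a + U_(i))%MM, Z) w.
  apply/in_coneP/orP => [[aw awZ] | [] /in_coneP[aw awZ]].
  - have [awi | awi] := eqVneq (a i) (w i); [left | right]; apply/in_coneP.
      by split=> // j; rewrite !inE negb_and negbK => /orP[/eqP -> | /awZ].
    move/mnm_lepP in aw; split.
      apply/mnm_lepP => j; rewrite mnmDE mnm1E.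
      by have [<- | _] := eqVneq i j; have := aw i; have := aw j; lia.
    move=> j jZ; rewrite mnmDE mnm1E (awZ j jZ).
    by have [ij | _] := eqVneq i j; [rewrite ij (negPf jZ) in iZ | rewrite addn0].
  - by split=> // j jZ; apply: awZ; rewrite !inE negb_and jZ orbT.
  - split; first exact: lepm_trans (lem_addr _ _) aw.
    move=> j jZ; rewrite -(awZ j jZ) mnmDE mnm1E.
    by have [ij | _] := eqVneq i j; [rewrite ij (negPf jZ) in iZ | rewrite addn0].
rewrite split_i.
have [/in_coneP[aw awZ] | _] //= := boolP (in_cone (a, Z :\ i) w).
have awi : a i = w i by apply: awZ; rewrite !inE eqxx.
have -> : in_cone ((a + U_(i))%MM, Z) w = false.
  apply/in_coneP => -[/mnm_lepP/(_ i)]; rewrite mnmDE mnm1E eqxx awi; lia.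
by case: mnm_lepP => // /(_ i); rewrite -awi leqNgt av.
Qed.

Lemma cones_minus n d (L : seq (cone n)) (v : 'X_{1..n}) :
  all (fun c : cone n => d <= #|c.2|)%N L ->
  exists2 L' : seq (cone n), all (fun c : cone n => d <= #|c.2|.+1)%N L' &
    forall w, count (in_cone^~ w) L' =
      (count (in_cone^~ w) L * ~~ (v <= w)%MM)%N.
Proof.
elim: L => [|[a Z] L IH] /=; first by exists [::].
case/andP=> dimZ /IH[L' dimL' cntL'].
have [L0 dimL0 cntL0] := cone_minus a Z v.
exists (L0 ++ L') => [|w].
  rewrite all_cat dimL' andbT; apply: sub_all dimL0 => c; exact: leq_trans dimZ.
by rewrite count_cat cntL0 cntL' mulnDl -mulnb.
Qed.

Lemma cone_minus_seq n (a : 'X_{1..n}) (vs : seq 'X_{1..n}) :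
  exists2 L : seq (cone n),
    all (fun c : cone n => n <= #|c.2| + size vs)%N L &
    forall w, count (in_cone^~ w) L =
      (a <= w)%MM && all (fun v => ~~ (v <= w)%MM) vs :> nat.
Proof.
elim: vs => [|v vs [L dimL cntL]] /=.
  exists [:: (a, setT)]; first by rewrite /= cardsT card_ord addn0 leqnn.
  move=> w /=; rewrite andbT addn0; congr (nat_of_bool _).
  by apply/in_coneP/idP => [[] // | aw]; split=> // i; rewrite inE.
have [|L' dimL' cntL'] := @cones_minus n (n - size vs)%N L v.
  by apply: sub_all dimL => c /=; lia.
exists L' => [|w]; first by apply: sub_all dimL' => c /=; lia.
by rewrite cntL' cntL mulnb -andbA [_ && ~~ _]andbC.
Qed.

(** * Partitioning the monomials of an ideal into cones *)

Definition mlcm_over n m (g : 'I_m -> 'X_{1..n}) (X : {set 'I_m}) : 'X_{1..n} :=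
  [multinom (\max_(j in X) g j i)%N | i < n].

Lemma mlcm_over_le n m (g : 'I_m -> 'X_{1..n}) (X : {set 'I_m}) w :
  (mlcm_over g X <= w)%MM = (X \subset [set j | (g j <= w)%MM]).
Proof.
apply/mnm_lepP/subsetP => [lew j jX | leX i].
  rewrite inE; apply/mnm_lepP => i; apply: leq_trans (lew i).
  by rewrite mnmE; apply: (@leq_bigmax_cond _ (mem X) (fun j => g j i)).
by rewrite mnmE; apply/bigmax_leqP => j /leX; rewrite inE => /mnm_lepP.
Qed.

(** One family of cones for each interval of the cyclic partition, applied to
    the set T w of the generators that divide w. *)
Lemma generators_partition n m (g : 'I_m -> 'X_{1..n}) :
  odd m ->
  exists2 L : seq (cone n), all (fun c : cone n => n - m./2 <= #|c.2|)%N L &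
    forall w, count (in_cone^~ w) L = [exists j, (g j <= w)%MM] :> nat.
Proof.
move=> oddm; pose T w := [set j | (g j <= w)%MM].
have one (Y : {set 'I_m}) : cyc_cover Y ->
    exists2 L : seq (cone n), all (fun c : cone n => n - m./2 <= #|c.2|)%N L &
    forall w, count (in_cone^~ w) L = (cyc_bottom Y \subset T w) && (T w \subset Y)
      :> nat.
  move=> covY.
  have [L dimL cntL] :=
    cone_minus_seq (mlcm_over g (cyc_bottom Y)) [seq g j | j <- enum (~: Y)].
  exists L => [|w].
    apply: sub_all dimL => c /=; rewrite size_map -cardE.
    move=> dimc; have := card_cyc_bottom covY; have := cardsC Y; rewrite card_ord.
    move: dimc; move: #|c.2| #|Y| #|~: Y| #|cyc_bottom Y| => a1 a2 a3 a4; lia.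
  rewrite cntL mlcm_over_le all_map; congr (nat_of_bool (_ && _)).
  apply/allP/subsetP => [ndiv j | TY j /=].
    by rewrite inE; apply: contraLR => jY; apply: ndiv; rewrite mem_enum inE.
  by rewrite mem_enum inE; apply: contra => gj; apply: TY; rewrite inE.
have many (Ys : seq {set 'I_m}) : all (@cyc_cover m) Ys ->
    exists2 L : seq (cone n), all (fun c : cone n => n - m./2 <= #|c.2|)%N L &
    forall w, count (in_cone^~ w) L =
      count (fun Y => (cyc_bottom Y \subset T w) && (T w \subset Y)) Ys.
  elim: Ys => [|Y Ys IH] /=; first by exists [::].
  case/andP=> /one[L1 dim1 cnt1] /IH[L2 dim2 cnt2].
  exists (L1 ++ L2) => [|w]; first by rewrite all_cat dim1.
  by rewrite count_cat cnt1 cnt2.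
have [|L dimL cntL] := many [seq Y <- enum {set 'I_m} | cyc_cover Y].
  exact: filter_all.
exists L => // w; rewrite cntL count_cyc_interval //; congr nat_of_bool.
by apply/set0Pn/existsP => -[j]; [rewrite inE | ]; exists j; rewrite ?inE.
Qed.

(** * Stanley decompositions from cones of monomials *)

Definition mrestrict (K : fieldType) n (p : pred 'X_{1..n}) (f : {mpoly K[n]}) :
    {mpoly K[n]} :=
  \sum_(w <- msupp f | p w) f@_w *: 'X_[w].

Lemma mcoeff_mrestrict (K : fieldType) n (p : pred 'X_{1..n}) (f : {mpoly K[n]}) w :
  (mrestrict p f)@_w = if p w then f@_w else 0.
Proof.
rewrite /mrestrict raddf_sum /=.
have [wf | wf] := boolP (w \in msupp f); last first.
  rewrite (memN_msupp_eq0 wf) if_same big1_seq // => v /andP[_ vf].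
  rewrite mcoeffZ mcoeffX; have [vw | _] := eqVneq v w; last by rewrite mulr0.
  by rewrite vw (negPf wf) in vf.
rewrite big_mkcond (bigD1_seq w) ?msupp_uniq //= big1 => [|v /negPf vw].
  by case: ifP; rewrite addr0 // mcoeffZ mcoeffX eqxx mulr1.
by case: ifP => // _; rewrite mcoeffZ mcoeffX vw mulr0.
Qed.

(** Since u K[Z] is spanned by monomials, its elements are recognised on their
    supports. *)
Lemma in_spanX (K : fieldType) n (a : 'X_{1..n}) Z (f : {mpoly K[n]}) :
  in_span 'X_[a] Z f <->
  {in msupp f, forall w, in_cone ((a, Z) : cone n) w}.
Proof.
split=> [[p pZ ->] w | coneF].
  rewrite mulrC (perm_mem (msuppMX p a)) => /mapP[b bp ->].
  apply/in_coneP; split=> [|i iZ]; first exact: lem_addr.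
  rewrite mnmDE; have [-> | bi] := eqVneq (b i) 0%N; first by rewrite addn0.
  by rewrite (pZ b bp i bi) in iZ.
exists (\sum_(w <- msupp f) f@_w *: 'X_[w - a]).
  move=> b /msupp_sum_le; rewrite filter_predT => /flattenP[_ /mapP[w wf ->]].
  move=> /msuppZ_le; rewrite msuppX inE => /eqP -> i.
  have /in_coneP[_ awZ] := coneF w wf.
  by rewrite mnmBE; apply: contraR => /awZ ->; rewrite subnn.
rewrite mulr_sumr {1}[f]mpolyE; apply: eq_big_seq => w wf.
have /in_coneP[aw _] := coneF w wf.
by rewrite -scalerAr -mpolyXD addmC submK.
Qed.

Lemma sum_in_cone (K : fieldType) n (L : seq (cone n)) w (x : K) :
  \sum_(i < size L) (if in_cone (tnth (in_tuple L) i) w then x else 0) =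
  x *+ count (in_cone^~ w) L.
Proof.
rewrite -big_mkcond -(big_tnth _ _ L (in_cone^~ w) (fun=> x)) /=.
by rewrite big_const_seq iter_addr_0.
Qed.

(** A set of monomials that is the disjoint union of finitely many cones (each
    monomial being counted once) gives a Stanley decomposition of its span. *)
Lemma cones_stanley_decomposition (K : fieldType) n (I : {pred {mpoly K[n]}})
    (D : pred 'X_{1..n}) (L : seq (cone n)) :
  (forall f, f \in I <-> {in msupp f, forall w, D w}) ->
  (forall w, count (in_cone^~ w) L = D w :> nat) ->
  stanley_decomposition I
    (fun i : 'I_(size L) => 'X_[(tnth (in_tuple L) i).1])
    (fun i => (tnth (in_tuple L) i).2).
Proof.
move=> memI cntL.
have spanE i (f : {mpoly K[n]}) :
    in_span 'X_[(tnth (in_tuple L) i).1] (tnth (in_tuple L) i).2 f <->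
    {in msupp f, forall w, in_cone (tnth (in_tuple L) i) w}.
  by rewrite in_spanX -surjective_pairing.
split=> [i | f | g spanG sum0 i].
- split; first by exists 1, (tnth (in_tuple L) i).1; rewrite scale1r.
  by move=> p _ /eqP; rewrite mulf_eq0 -msupp_eq0 msuppX => /eqP.
- rewrite memI; split=> [fD | [g spanG ->] w].
    exists (fun i => mrestrict (in_cone (tnth (in_tuple L) i)) f).
      move=> i; apply/spanE => w; rewrite mcoeff_msupp mcoeff_mrestrict.
      by case: ifP => //; rewrite eqxx.
    apply/mpolyP => w; rewrite raddf_sum /=.
    under eq_bigr do rewrite mcoeff_mrestrict.
    rewrite sum_in_cone cntL.
    have [/fD -> // | /memN_msupp_eq0 ->] := boolP (w \in msupp f).
    by rewrite mul0rn.
  move=> /msupp_sum_le; rewrite filter_predT => /flattenP[_ /mapP[i _ ->] wg].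
  have wi := (spanE i (g i)).1 (spanG i) w wg.
  have: (0 < count (in_cone^~ w) L)%N.
    by rewrite -has_count; apply/hasP; exists (tnth (in_tuple L) i); rewrite ?mem_tnth.
  by rewrite cntL; case: (D w).
- have inL (j : 'I_(size L)) w : (g j)@_w != 0 -> in_cone (tnth (in_tuple L) j) w.
    by rewrite -mcoeff_msupp; apply: (spanE j _).1.
  apply/mpolyP => w; rewrite mcoeff0; apply/eqP/negPn/negP => giw.
  have Lw : count (in_cone^~ w) L = 1%N.
    have: (0 < count (in_cone^~ w) L)%N.
      rewrite -has_count; apply/hasP.
      by exists (tnth (in_tuple L) i); rewrite ?mem_tnth ?inL.
    by rewrite cntL; case: (D w).
  have uniq_i (j : 'I_(size L)) : j != i -> (g j)@_w = 0.
    move=> ji; apply/eqP; apply: contraT => /inL wj.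
    suff: (1 < count (in_cone^~ w) L)%N by rewrite Lw.
    rewrite -sum1_count big_tnth sum1_card; apply/card_gt1P.
    by exists i, j; split=> //; [exact: inL | rewrite eq_sym].
  have /(congr1 (mcoeff w)) := sum0; rewrite mcoeff0 raddf_sum /=.
  have -> : \sum_(j < size L) (g j)@_w = (g i)@_w.
    by rewrite (bigD1 i) //= big1 ?addr0.
  by apply/eqP.
Qed.

Lemma sdepth_dec_ge n s (Z : 'I_s -> {set 'I_n}) d :
  (d <= n)%N -> (forall i, d <= #|Z i|)%N -> (d <= sdepth_dec Z)%N.
Proof.
by move=> dn dZ; rewrite /sdepth_dec; elim/big_ind: _ => // x y; rewrite leq_min => ->.
Qed.

Lemma sdepth_dec_le n s (Z : 'I_s -> {set 'I_n}) i : (sdepth_dec Z <= #|Z i|)%N.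
Proof.
rewrite /sdepth_dec; have: i \in index_enum _ := mem_index_enum i.
elim: index_enum => // j r IH; rewrite inE big_cons geq_min.
by case/orP=> [/eqP -> | /IH ->]; rewrite ?leqnn ?orbT.
Qed.

Lemma sdepth_dec_le_nvars n s (Z : 'I_s -> {set 'I_n}) : (sdepth_dec Z <= n)%N.
Proof.
rewrite /sdepth_dec; elim/big_ind: _ => // [x y xn _ | i _].
  by rewrite geq_min xn.
by rewrite -[leqRHS]card_ord max_card.
Qed.

Lemma mem_generated (K : fieldType) n (I : {pred {mpoly K[n]}})
    (G : {fset 'X_{1..n}}) :
  generates (mem G) I ->
  forall f, f \in I <-> {in msupp f, forall w, has (fun g => (g <= w)%MM) G}.
Proof.
move=> genI f; rewrite genI; split=> [[s [c [sG ->]]] w | fG].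
  move=> /msupp_sum_le; rewrite filter_predT => /flattenP[_ /mapP[g gs ->]].
  rewrite (perm_mem (msuppMX _ _)) => /mapP[b _ ->]; apply/hasP; exists g.
    exact: sG.
  exact: lem_addr.
pose gen w := nth w G (find (fun g => (g <= w)%MM) G).
have genG w : w \in msupp f -> gen w \in G.
  by move=> /fG hasw; rewrite mem_nth // -has_find.
have gen_le w : w \in msupp f -> (gen w <= w)%MM.
  by move=> /fG hasw; apply: (nth_find w hasw).
exists G, (fun g => \sum_(w <- msupp f | gen w == g) f@_w *: 'X_[w - g]).
split=> //; under eq_bigr do rewrite mulr_suml.
rewrite (exchange_big_dep predT) //= {1}[f]mpolyE; apply: eq_big_seq => w wf.
rewrite big_mkcond (bigD1_seq (gen w)) ?genG //= eqxx big1_seq => [|g].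
  by rewrite addr0 -scalerAl -mpolyXD submK ?gen_le.
by case/andP => /negPf gw _; rewrite eq_sym gw.
Qed.

(** * Primes that are colons of a monomial ideal *)

Section GradedIdeal.
Variables (K : fieldType) (n : nat) (I : {pred {mpoly K[n]}}).
Variable D : pred 'X_{1..n}.
Hypothesis memI : forall f, f \in I <-> {in msupp f, forall w, D w}.
Hypothesis D_up : forall v w, D w -> D (v + w)%MM.

Lemma graded_mull f g : f \in I -> g * f \in I.
Proof.
move=> /memI fD; apply/memI => _ /msuppM_le /allpairsP[[v w] /= [_ wf ->]].
exact/D_up/fD.
Qed.

Lemma graded_sub f g : f \in I -> g \in I -> f - g \in I.
Proof.
move=> /memI fD /memI gD; apply/memI => w /msuppB_le.
by rewrite mem_cat => /orP[/fD | /gD].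
Qed.

Lemma graded_add f g : f \in I -> g \in I -> f + g \in I.
Proof.
move=> /memI fD /memI gD; apply/memI => w /msuppD_le.
by rewrite mem_cat => /orP[/fD | /gD].
Qed.

Lemma graded_monom w : 'X_[w] \in I <-> D w.
Proof.
rewrite memI; split=> [-> // | Dw v]; first by rewrite msuppX inE.
by rewrite msuppX inE => /eqP ->.
Qed.

(** The leading term of g f lies in I, so x^b times the leading term of f does,
    with b the leading exponent of g; induct on the number of terms of f. *)
Lemma mlead_exp_colon f g : g != 0 -> g * f \in I ->
  exists r, 'X_[mlead g] ^+ r * f \in I.
Proof.
move=> g0 gfI; set b := mlead g.
suff: forall N f, (size (msupp f) < N)%N -> forall c, g * ('X_[b] ^+ c * f) \in I ->
    exists r, 'X_[b] ^+ r * f \in I.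
  by move=> /(_ _ f (ltnSn _) 0%N); apply; rewrite expr0 mul1r.
elim=> // N IH {gfI} {}f; rewrite ltnS => szf c gfI.
have [f0 | f0] := eqVneq f 0.
  by exists 0%N; apply/memI => w; rewrite f0 mulr0 msupp0.
set a := mlead f; set t := f@_a *: 'X_[a].
have tI : 'X_[b] ^+ c.+1 * t \in I.
  rewrite /t -scalerAr -mul_mpolyC; apply: graded_mull.
  rewrite mpolyXn -mpolyXD; apply/graded_monom; move/memI: gfI; apply.
  have Xf0 : 'X_[b] ^+ c * f != 0.
    by rewrite mulf_neq0 // expf_neq0 // -msupp_eq0 msuppX.
  have -> : (b *+ c.+1 + a = mlead (g * ('X_[b] ^+ c * f)))%MM.
    rewrite mleadM // mpolyXn mleadM //; last by rewrite -msupp_eq0 msuppX.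
    by rewrite mleadXm mulmS addmA.
  by rewrite mlead_supp // mulf_neq0.
have [||r rI] := IH (f - t) _ c.+1.
- apply: leq_trans szf; rewrite (perm_size (msupp_rem _ _)) size_rem ?mlead_supp //.
  by rewrite prednK // lt0n size_eq0 msupp_eq0.
- rewrite mulrBr mulrBr; apply: graded_sub; last exact: graded_mull.
  rewrite exprS -mulrA mulrCA; exact: graded_mull.
exists (c.+1 + r)%N.
have -> : f = (f - t) + t by rewrite subrK.
rewrite mulrDr; apply: graded_add; rewrite exprD.
  by rewrite -mulrA; apply: graded_mull.
by rewrite -mulrA mulrCA; apply: graded_mull.
Qed.

End GradedIdeal.

Section Prime.
Variables (K : fieldType) (n : nat) (P : {pred {mpoly K[n]}}).
Hypothesis P_prime : prime_ideal P.

Lemma prime_prod (J : Type) (r : seq J) (F : J -> {mpoly K[n]}) :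
  \prod_(j <- r) F j \in P -> exists j, F j \in P.
Proof.
have [[_ P1 _] Pprime] := P_prime.
elim: r => [|j r IH]; first by rewrite big_nil (negPf P1).
by rewrite big_cons => /Pprime/orP[] // ?; exists j.
Qed.

Lemma prime_exp f k : f ^+ k \in P -> f \in P.
Proof. by rewrite -[k]card_ord -prodr_const => /prime_prod[]. Qed.

Lemma prime_monom_var b : 'X_[b] \in P -> exists2 i, b i != 0%N & 'X_i \in P.
Proof.
have [[_ P1 _] _] := P_prime.
rewrite mpolyXE_id => /prime_prod[i Xi]; exists i; last exact: prime_exp Xi.
by apply: contraNneq P1 => bi; rewrite bi expr0 in Xi.
Qed.

End Prime.

Section Colon.
Variables (K : fieldType) (n : nat) (I P : {pred {mpoly K[n]}}).
Variable D : pred 'X_{1..n}.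
Hypothesis memI : forall f, f \in I <-> {in msupp f, forall w, D w}.
Hypothesis D_up : forall v w, D w -> D (v + w)%MM.
Hypothesis P_prime : prime_ideal P.
Variable f : {mpoly K[n]}.
Hypothesis P_colon : forall g, g \in P <-> g * f \in I.

(** A power of the leading monomial of g multiplies f into I, so it lies in P.
    In particular no nonzero polynomial in the variables outside P lies in P. *)
Lemma colon_prime_var g : g \in P -> g != 0 ->
  exists2 i, mlead g i != 0%N & 'X_i \in P.
Proof.
move=> /P_colon gfI g0; apply: (prime_monom_var P_prime).
have [r /P_colon] := mlead_exp_colon memI D_up g0 gfI.
exact: prime_exp.
Qed.

(** Otherwise the monomial with exponent N at the variables outside P would
    multiply every term of f into I, hence would lie in P. *)
Lemma colon_prime_monom (N : nat) : exists a,
  (forall i, 'X_i \in P -> D (a + U_(i))%MM) /\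
  ~~ D (a + [multinom if 'X_i \in P then 0 else N | i < n])%MM.
Proof.
set b := [multinom _ | _ < _].
have: ~~ all (fun a => D (a + b)%MM) (msupp f).
  apply/negP => /allP allD.
  have /P_colon/(prime_monom_var P_prime)[i] : 'X_[b] * f \in I.
    apply/memI => w; rewrite mulrC (perm_mem (msuppMX _ _)) => /mapP[a af ->].
    by rewrite addmC; apply: allD.
  by rewrite mnmE => bi Xi; rewrite Xi in bi.
rewrite -has_predC => /hasP[a af aD]; exists a; split=> // i /P_colon/memI; apply.
by rewrite mulrC (perm_mem (msuppMX _ _)) addmC map_f.
Qed.

End Colon.

(** * Height and the growth of independent families *)

Definition free_mod (K : fieldType) n (Q : {pred {mpoly K[n]}}) (J : finType)
    (w : J -> {mpoly K[n]}) : Prop :=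
  forall c : J -> K, \sum_j c j *: w j \in Q -> forall j, c j = 0.

(** The quotient by Q contains, for every N, a free family of N^d elements of
    degree O(N): a form of the statement that its dimension is at least d. *)
Definition growth (K : fieldType) n (Q : {pred {mpoly K[n]}}) (d : nat) : Prop :=
  exists C, forall N, exists (J : finType) (w : J -> {mpoly K[n]}),
    [/\ #|J| = (N ^ d)%N, forall j, (msize (w j) <= (N * C).+1)%N & free_mod Q w].

Lemma sub_prime_ideal (K : fieldType) n (Q : {pred {mpoly K[n]}}) f g :
  prime_ideal Q -> f \in Q -> g \in Q -> f - g \in Q.
Proof.
by case=> -[_ _ Qlin] _ fQ gQ; rewrite addrC -mulN1r; apply: Qlin.
Qed.

Lemma mull_prime_ideal (K : fieldType) n (Q : {pred {mpoly K[n]}}) f g :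
  prime_ideal Q -> g \in Q -> f * g \in Q.
Proof. by case=> -[Q0 _ Qlin] _ gQ; rewrite -[f * g]addr0; apply: Qlin. Qed.

(** Given a relation modulo Q, its part of g-degree 0 lies in Q', so its
    coefficients vanish; the rest is g times a shorter relation, and g can be
    cancelled modulo the prime Q. *)
Lemma free_mod_powers (K : fieldType) n (Q Q' : {pred {mpoly K[n]}}) g
    (J : finType) (w : J -> {mpoly K[n]}) N :
  prime_ideal Q -> prime_ideal Q' -> {subset Q <= Q'} -> g \in Q' -> g \notin Q ->
  free_mod Q' w ->
  free_mod Q (fun kj : 'I_N * J => g ^+ kj.1 * w kj.2).
Proof.
move=> Qprime Q'prime QQ' gQ' gQ free_w c sumQ.
pose V N (c : nat -> J -> K) := \sum_(k < N) g ^+ k * \sum_j c k j *: w j.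
have freeV : forall N c, V N c \in Q -> forall k j, (k < N)%N -> c k j = 0.
  elim=> // {}N IH {sumQ}c; rewrite /V big_ord_recl expr0 mul1r.
  have -> : \sum_(k < N) g ^+ lift ord0 k * \sum_j c (lift ord0 k) j *: w j
      = g * V N (fun k => c k.+1).
    by rewrite /V mulr_sumr; apply: eq_bigr => k _; rewrite lift0 exprS -mulrA.
  move=> VQ.
  have c0 : forall j, c 0%N j = 0.
    apply: free_w; set s := \sum_j _.
    rewrite -[s](addrK (g * V N (fun k => c k.+1))) sub_prime_ideal //.
      exact: QQ'.
    by rewrite mulrC mull_prime_ideal.
  move=> [|k] j // ltkN; apply: (IH (fun k => c k.+1)) => //.
  move: VQ; rewrite big1 ?add0r => [|j' _]; last by rewrite c0 scale0r.
  by case: Qprime => _ Qpr /Qpr/orP[] //; rewrite (negPf gQ).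
pose c' k j := if insub k is Some i then c (i, j) else 0.
have c'E (k : 'I_N) j : c' k j = c (k, j) by rewrite /c' valK.
move=> [k j]; rewrite -c'E; apply: (freeV N) (ltn_ord k).
suff -> : V N c' = \sum_(kj : 'I_N * J) c kj *: (g ^+ kj.1 * w kj.2) by [].
transitivity (\sum_(i < N) \sum_j' c (i, j') *: (g ^+ i * w j')).
  apply: eq_bigr => i _; rewrite mulr_sumr; apply: eq_bigr => j' _.
  by rewrite c'E scalerAr.
by rewrite pair_bigA; apply: eq_bigr => -[].
Qed.

Lemma growth_step (K : fieldType) n (Q Q' : {pred {mpoly K[n]}}) d :
  prime_ideal Q -> prime_ideal Q' -> {subset Q <= Q'} ->
  (exists2 g, g \in Q' & g \notin Q) ->
  growth Q' d -> growth Q d.+1.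
Proof.
move=> Qprime Q'prime QQ' [g gQ' gQ] [C growQ'].
have g0 : g != 0 by apply: contraNneq gQ => ->; case: Qprime => -[].
have msize_exp k : (msize (g ^+ k) <= (k * (msize g).-1).+1)%N.
  elim: k => [|k IH]; first by rewrite expr0 msize1.
  rewrite exprS msizeM ?expf_neq0 // mulSn; move: IH.
  by move: (msize (g ^+ k)) (msize g) => a b; lia.
exists (C + (msize g).-1)%N => N; have [J [w [cardJ sizew freew]]] := growQ' N.
exists ('I_N * J)%type, (fun kj : 'I_N * J => g ^+ kj.1 * w kj.2).
split; last exact: free_mod_powers freew.
  by rewrite card_prod card_ord cardJ expnS.
move=> [k j] /=; have [-> | wj0] := eqVneq (w j) 0; first by rewrite mulr0 msize0.
rewrite msizeM ?expf_neq0 //.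
have := msize_exp k; have := sizew j; have := ltn_ord k.
move: (msize (g ^+ k)) (msize (w j)) (msize g).-1 => a b e; nia.
Qed.

(** The N^d elements are independent vectors in the space of the polynomials
    with all exponents at most N C, of dimension (N C + 1)^n; this fails for
    d > n and N > (C + 1)^n. *)
Lemma growth_bound (K : fieldType) n (Q : {pred {mpoly K[n]}}) d :
  prime_ideal Q -> growth Q d -> (d <= n)%N.
Proof.
move=> [[Q0 _ _] _] [C grow]; rewrite leqNgt; apply/negP => lt_nd.
pose N := (C.+1 ^ n).+1; have [J [w [cardJ sizew freew]]] := grow N.
pose T := {ffun 'I_n -> 'I_(N * C).+1}.
pose M := \matrix_(j < #|J|, t < #|T|)
  (w (enum_val j))@_[multinom (enum_val t i : nat) | i < n].
have: row_free M.
  apply: inj_row_free => v vM0; apply/rowP => j; rewrite mxE.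
  rewrite -[j]enum_valK; apply: (freew (fun j => v 0 (enum_rank j))).
  suff -> : \sum_j v 0 (enum_rank j) *: w j = 0 by [].
  apply/mpolyP => a; rewrite mcoeff0 raddf_sum /=.
  have [lta | lea] := ltnP (mdeg a) (N * C).+1; last first.
    apply: big1 => i _; rewrite mcoeffZ memN_msupp_eq0 ?mulr0 //.
    by apply: msize_mdeg_ge; apply: leq_trans (sizew i) lea.
  have ai i : (a i < (N * C).+1)%N.
    by apply: leq_ltn_trans lta; rewrite mdegE (bigD1 i) //= leq_addr.
  pose t : T := [ffun i => Ordinal (ai i)].
  move/rowP: vM0 => /(_ (enum_rank t)); rewrite !mxE.
  rewrite (reindex enum_rank) /=; last exact/onW_bij/enum_rank_bij.
  move=> vMt; rewrite -[RHS]vMt; apply: eq_bigr => i _.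
  rewrite mcoeffZ mxE !enum_rankK.
  by congr (_ * _@_ _); apply/mnmP => k; rewrite mnmE ffunE.
rewrite /row_free => /eqP rankM; have := rank_leq_col M.
rewrite rankM cardJ card_ffun !card_ord leqNgt => /negP[].
have N0 : (0 < N)%N by [].
have le1 : ((N * C).+1 ^ n <= (N * C.+1) ^ n)%N.
  by have [-> // | n_gt0] := posnP n; rewrite leq_exp2r //; lia.
apply: leq_ltn_trans le1 _; rewrite expnMn.
apply: (@leq_trans (N ^ n.+1)); last by rewrite leq_pexp2l.
by rewrite expnSr ltn_pmul2l ?expn_gt0.
Qed.

Lemma chain_growth (K : fieldType) n (P : {pred {mpoly K[n]}}) h Q d :
  prime_chain P h Q -> growth P d -> growth (Q 0%N) (d + h)%N.
Proof.
case=> Qprime Qsub QhP growP.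
have: growth (Q h) d.
  have [C grow] := growP; exists C => N; have [J [w [cardJ sizew freew]]] := grow N.
  by exists J, w; split=> // c; rewrite QhP; apply: freew.
elim: h d Qprime Qsub {growP QhP} => [|h IH] d Qprime Qsub growQ.
  by rewrite addn0.
rewrite addnS -addSn; apply: IH => [i lih | i lih |].
- exact: Qprime (ltnW _).
- exact: Qsub (ltnW _).
have [QQ exg] := Qsub h (ltnSn h).
exact: growth_step (Qprime _ _) (Qprime _ _) QQ exg growQ.
Qed.

(** The monomials in the variables of B with exponents less than N are free
    modulo P: the leading monomial of a combination involves no variable
    outside B. *)
Lemma growth_vars (K : fieldType) n (P : {pred {mpoly K[n]}}) (B : {set 'I_n}) :
  (forall f, f \in P -> f != 0 -> exists2 i, mlead f i != 0%N & i \notin B) ->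
  growth P #|B|.
Proof.
move=> leadP; exists n => N.
pose J := {ffun {i | i \in B} -> 'I_N}.
pose e (j : J) : 'X_{1..n} :=
  [multinom (if insub i is Some b then j b : nat else 0%N) | i < n].
exists J, (fun j => 'X_[e j]); split.
- by rewrite card_ffun card_ord card_sig.
- move=> j; rewrite msizeX ltnS mdegE.
  apply: (@leq_trans (\sum_(i < n) N)); last first.
    by rewrite sum_nat_const card_ord mulnC.
  by apply: leq_sum => i _; rewrite mnmE; case: insub => // b; apply: ltnW.
have e_inj : injective e.
  move=> j1 j2 /mnmP ej; apply/ffunP => b; apply: val_inj.
  by have := ej (val b); rewrite !mnmE valK.
move=> c sumP j; set g := \sum_j _ in sumP.
have gE j' : g@_(e j') = c j'.
  rewrite raddf_sum (bigD1 j') //= big1 => [|j'' /negPf jj].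
    by rewrite addr0 mcoeffZ mcoeffX eqxx mulr1.
  by rewrite mcoeffZ mcoeffX (inj_eq e_inj) jj mulr0.
apply/eqP; apply: contraT => cj.
have g0 : g != 0 by apply: contraNneq cj => g0; rewrite -gE g0 mcoeff0.
have [i lead_i iB] := leadP g sumP g0.
have := mlead_supp g0 => /msupp_sum_le; rewrite filter_predT.
case/flattenP => _ /mapP[j' _ ->] /msuppZ_le; rewrite msuppX inE => /eqP leadE.
case/eqP: lead_i; rewrite leadE mnmE insubF //; exact: negPf.
Qed.

Lemma colon_prime_height (K : fieldType) n (I P : {pred {mpoly K[n]}})
    (D : pred 'X_{1..n}) f h :
  (forall f, f \in I <-> {in msupp f, forall w, D w}) ->
  (forall v w, D w -> D (v + w)%MM) ->
  prime_ideal P -> (forall g, g \in P <-> g * f \in I) -> has_height P h ->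
  (h <= #|[set i : 'I_n | 'X_i \in P]|)%N.
Proof.
move=> memI D_up Pprime Pf [[Q chainQ] _].
set A := [set i | _].
have growP : growth P #|~: A|.
  apply: growth_vars => g gP g0.
  have [i lead_i Xi] := colon_prime_var memI D_up Pprime Pf gP g0.
  by exists i; rewrite ?inE ?negbK.
have Q0prime : prime_ideal (Q 0%N) by case: chainQ => + _ _; apply.
have := growth_bound Q0prime (chain_growth chainQ growP).
by have := cardsC A; rewrite card_ord; lia.
Qed.

(** * The upper bound *)

(** Double counting: the out-degrees and the in-degrees have the same sum, and
    their total is at most |A| (|A| - 1). *)
Lemma tournament_outdegree (T : finType) (A : {set T}) (e : rel T) :
  A != set0 -> irreflexive e -> (forall i k, e i k -> ~~ e k i) ->
  exists2 i, i \in A & (#|[set k in A | e i k]|.*2 < #|A|)%N.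
Proof.
move=> A0 irr asym; apply/exists_inP; apply: contraT.
rewrite negb_exists_in => /forall_inP big_out.
have sumE : (\sum_(i in A) #|[set k in A | e i k]| =
    \sum_(i in A) \sum_(k in A) e i k)%N.
  apply: eq_bigr => i _; rewrite -sum1_card (eq_bigl (fun k => (k \in A) && e i k)).
    by rewrite big_mkcondr.
  by move=> k; rewrite inE.
have le1 : (\sum_(i in A) (#|[set k in A | e i k]|.*2) <= \sum_(i in A) #|A|.-1)%N.
  under eq_bigr do rewrite -addnn.
  rewrite big_split /= {2}sumE exchange_big sumE -big_split /=.
  apply: leq_sum => i iA; rewrite -big_split /= (bigD1 i) //= irr addn0 add0n.
  rewrite (cardsD1 i A) iA add1n /= -sum1_card.
  rewrite [leqRHS](eq_bigl (fun k => (k \in A) && (k != i))).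
    apply: leq_sum => k _; have := asym i k.
    by case: (e i k) => [/(_ isT)/negPf -> | _] //; case: (e k i).
  by move=> k; rewrite !inE andbC.
have lt2 : (\sum_(i in A) #|A|.-1 < \sum_(i in A) (#|[set k in A | e i k]|.*2))%N.
  apply: (@leq_trans (\sum_(i in A) #|A|)).
    by rewrite !sum_nat_const ltn_pmul2l ?prednK // card_gt0.
  by apply: leq_sum => i /big_out; rewrite -leqNgt.
by rewrite ltnNge le1 in lt2.
Qed.

Section Upper.
Variables (K : fieldType) (n : nat) (I : {pred {mpoly K[n]}}).
Variable D : pred 'X_{1..n}.
Hypothesis memI : forall f, f \in I <-> {in msupp f, forall w, D w}.
Variables (s : nat) (u : 'I_s -> {mpoly K[n]}) (Z : 'I_s -> {set 'I_n}).
Hypothesis dec : stanley_decomposition I u Z.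

Lemma in_vars_monom (Y : {set 'I_n}) (b : 'X_{1..n}) :
  (forall i, b i != 0%N -> i \in Y) -> in_vars Y ('X_[b] : {mpoly K[n]}).
Proof. by move=> bY a; rewrite msuppX inE => /eqP ->. Qed.

(** Only the combinatorial content of a decomposition matters for the upper
    bound: its cones partition the monomials of I. *)
Lemma stanley_decomposition_cones : exists a : 'I_s -> 'X_{1..n},
  [/\ forall w, D w -> exists i, in_cone ((a i, Z i) : cone n) w,
      forall w i, in_cone ((a i, Z i) : cone n) w -> D w
    & forall w i j, in_cone ((a i, Z i) : cone n) w ->
        in_cone ((a j, Z j) : cone n) w -> i = j].
Proof.
have [space gen free] := dec.
have lead i : {ca : K * 'X_{1..n} | ca.1 != 0 & u i = ca.1 *: 'X_[ca.2]}.
  have ui0 : u i != 0.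
    apply/eqP => ui0; have [_ /(_ 1)] := space i; rewrite ui0 mul0r.
    have -> : 1 = 'X_[0%MM] :> {mpoly K[n]} by rewrite mpolyX0.
    have Z0 : in_vars (Z i) ('X_[0%MM] : {mpoly K[n]}).
      by apply: in_vars_monom => k; rewrite mnm0E.
    by move=> /(_ Z0 erefl)/eqP; rewrite mpolyX0 oner_eq0.
  exists ((u i)@_(mlead (u i)), mlead (u i)) => /=; first by rewrite mleadc_eq0.
  have [[c [a ua]] _] := space i; rewrite ua in ui0 *.
  have c0 : c != 0 by apply: contraNneq ui0 => ->; rewrite scale0r.
  by rewrite mleadZ // mleadXm mcoeffZ mcoeffX eqxx mulr1.
pose c i := (s2val (lead i)).1; pose a i := (s2val (lead i)).2.
have c0 i : c i != 0 := s2valP (lead i).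
have uE i : u i = c i *: 'X_[a i] := s2valP' (lead i).
have spanP i f : in_span (u i) (Z i) f ->
    {in msupp f, forall w, in_cone ((a i, Z i) : cone n) w}.
  case=> p pZ ->; apply/in_spanX; exists (c i *: p); last first.
    by rewrite uE -scalerAl scalerAr.
  by move=> b /msuppZ_le; apply: pZ.
have spanX i w : in_cone ((a i, Z i) : cone n) w -> in_span (u i) (Z i) 'X_[w].
  move=> /in_coneP[aw awZ]; exists ((c i)^-1 *: 'X_[w - a i]); last first.
    by rewrite uE -scalerAl -scalerAr scalerA divff // scale1r -mpolyXD addmC submK.
  move=> b /msuppZ_le; rewrite msuppX inE => /eqP -> k.
  by rewrite mnmBE; apply: contraR => /awZ ->; rewrite subnn.
have span0 i : in_span (u i) (Z i) 0.
  by exists 0; rewrite ?mulr0 // => b; rewrite msupp0.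
exists a; split=> [w Dw | w i wi | w i j wi wj].
- have /gen[g spang sumg] : 'X_[w] \in I.
    by apply/memI => v; rewrite msuppX inE => /eqP ->.
  have: w \in msupp (\sum_(i < s) g i) by rewrite -sumg msuppX inE.
  move=> /msupp_sum_le; rewrite filter_predT => /flattenP[_ /mapP[i _ ->] wg].
  by exists i; apply: spanP wg.
- have /memI : 'X_[w] \in I.
    apply/gen; exists (fun j => if j == i then 'X_[w] else 0).
      by move=> j; case: eqP => [-> | _]; [apply: spanX | apply: span0].
    by rewrite -big_mkcond big_pred1_eq.
  by apply; rewrite msuppX inE.
apply/eqP; apply: contraT => ij.
pose g k : {mpoly K[n]} := if k == i then 'X_[w] else if k == j then - 'X_[w] else 0.
have: g i = 0.
  apply: free => [k|].
    rewrite /g; case: eqP => [-> | _]; first exact: spanX.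
    case: eqP => [-> | _]; last exact: span0.
    have [p pZ ->] := spanX _ _ wj; exists (- p); last by rewrite mulrN.
    by move=> b; rewrite (perm_mem (msuppN p)); apply: pZ.
  rewrite (bigD1 i) //= (bigD1 j) /=; last by rewrite eq_sym.
  rewrite {1 2}/g !eqxx eq_sym (negPf ij) big1 ?addr0 ?subrr // => k /andP[ki kj].
  by rewrite /g (negPf ki) (negPf kj).
by rewrite /g eqxx => /eqP; rewrite -msupp_eq0 msuppX.
Qed.

(** The cone that contains p i = x^a x_i (prod_{k not in A} x_k)^N has an apex with
    exponent a_i + 1 at i and at most a_k at every other k in A: otherwise the
    apex would divide a monomial outside I.  So two such cones are different,
    whereas if the cone of i is free in k and that of k is free in i, both
    contain (p i) x_k = (p k) x_i. *)
Lemma sdepth_dec_le_local (A : {set 'I_n}) :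
  A != set0 ->
  (forall N, exists a, (forall i, i \in A -> D (a + U_(i))%MM) /\
     ~~ D (a + [multinom if i \in A then 0 else N | i < n])%MM) ->
  (forall v w, D w -> D (v + w)%MM) ->
  (sdepth_dec Z <= n - #|A|./2)%N.
Proof.
move=> A0 local D_up.
have [b [coverD coneD disj]] := stanley_decomposition_cones.
(* Larger than every exponent of every apex, so that a cone through some p i is
   free in all the variables outside A. *)
pose N := (\max_(j < s) \max_(k < n) b j k).+1.
have [a [Da NDa]] := local N.
set t := [multinom _ | _ < _] in NDa.
pose p i := (a + t + U_(i))%MM.
have Dp i : i \in A -> D (p i).
  by move=> /Da /(D_up t); rewrite addmA [(t + a)%MM]addmC.
have [c cP] : exists c : 'I_n -> 'I_s, forall i, i \in A ->
    in_cone ((b (c i), Z (c i)) : cone n) (p i).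
  have [i0 i0A] := set0Pn _ A0; have [j0 _] := coverD _ (Dp _ i0A).
  exists (fun i => odflt j0 [pick j | in_cone ((b j, Z j) : cone n) (p i)]).
  move=> i /Dp/coverD[j ji]; case: pickP => //= /(_ j).
  by rewrite ji.
have apex i : i \in A -> b (c i) i = (a i).+1.
  move=> iA; have /in_coneP[/mnm_lepP bp bpZ] := cP i iA.
  have pi : p i i = (a i).+1 by rewrite !mnmDE mnm1E eqxx mnmE iA addn0 addn1.
  apply/eqP; rewrite eqn_leq -{1}pi bp /= ltnNge; apply: contra NDa => le_bi.
  have: D (b (c i)).
    by apply: (coneD _ (c i)); apply/in_coneP; split; rewrite ?lepm_refl.
  have /submK <- : (b (c i) <= a + t)%MM; last exact: D_up.
  apply/mnm_lepP => k; have := bp k; rewrite !mnmDE mnm1E.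
  by have [<- | _] := eqVneq i k; [move=> _; apply: leq_trans le_bi (leq_addr _ _)
                                  | rewrite addn0].
have free_out i k : i \in A -> k \notin A -> k \in Z (c i).
  move=> iA kA; apply: contraT => kZ.
  have /in_coneP[_ /(_ k kZ)] := cP i iA.
  rewrite !mnmDE mnmE (negPf kA) => bk.
  have: (b (c i) k < N)%N.
    rewrite ltnS (leq_trans (@leq_bigmax _ (fun k => b (c i) k) k)) //.
    exact: (@leq_bigmax _ (fun j => \max_(k < n) b j k)%N (c i)).
  by rewrite bk; lia.
pose e i k := [&& i \in A, k \in A, i != k & k \in Z (c i)].
have irr : irreflexive e by move=> i; rewrite /e eqxx !andbF.
have asym i k : e i k -> ~~ e k i.
  case/and4P=> iA kA ik kZ; apply/negP => /and4P[_ _ _ iZ].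
  have ray x y : x \in A -> y \in Z (c x) ->
      in_cone ((b (c x), Z (c x)) : cone n) (p x + U_(y))%MM.
    move=> xA yZ; have /in_coneP[bp bpZ] := cP x xA.
    apply/in_coneP; split=> [|z zZ]; first exact: lepm_trans (lem_addr _ _).
    rewrite mnmDE (bpZ z zZ) mnm1E; case: eqVneq => [yz|_]; last by rewrite addn0.
    by rewrite yz (negPf zZ) in yZ.
  have cik : c i = c k.
    apply: (disj (p i + U_(k))%MM); first exact: ray.
    by rewrite /p -addmA [(U_(i) + _)%MM]addmC addmA; apply: ray.
  have /in_coneP[/mnm_lepP/(_ k)] := cP i iA.
  rewrite cik apex // !mnmDE mnm1E (negPf ik) mnmE kA; lia.
have [i iA out_i] := tournament_outdegree A0 irr asym.
apply: leq_trans (sdepth_dec_le Z (c i)) _.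
have subZ : Z (c i) \subset [set k in A | e i k] :|: (i |: ~: A).
  apply/subsetP => k kZ; rewrite !inE /e iA kZ andbT /= eq_sym.
  by case: (k \in A) => //=; case: (k == i).
have [leU _] := leq_card_setU [set k in A | e i k] (i |: ~: A).
have := leq_trans (subset_leq_card subZ) leU; rewrite cardsU1 inE iA /=.
have := cardsC A; rewrite card_ord; move: out_i.
move: #|Z _| #|A| #|~: A| #|[set k in A | _]| => z x y o; lia.
Qed.

End Upper.

(** * The Stanley depth *)

Local Open Scope fset_scope.

Theorem corollary1p4 (K : fieldType) (n m : nat) (I : {pred {mpoly K[n]}})
    (G : {fset 'X_{1..n}})
    (I_monomial : monomial_ideal I)
    (G_gens : minimal_generators G I)
    (card_G : #|` G| = m)
    (m_odd : odd m)
    (ex_P : exists (P : {pred {mpoly K[n]}}) (h : nat),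
        [/\ associated_prime I P, has_height P h & (m - 1 <= h)%N]) :
  has_sdepth I (n - m./2).
Proof.
pose D w := has (fun g => (g <= w)%MM) G.
have memI : forall f, f \in I <-> {in msupp f, forall w, D w}.
  exact: mem_generated (proj1 G_gens).
have D_up v w : D w -> D (v + w)%MM.
  by apply: sub_has => g gw; apply: lepm_trans gw (lem_addl _ _).
have upper s (u : 'I_s -> {mpoly K[n]}) (Z : 'I_s -> {set 'I_n}) :
    stanley_decomposition I u Z -> (sdepth_dec Z <= n - m./2)%N.
  move=> dec; have [P [h [[P_prime [f Pf]] P_height le_mh]]] := ex_P.
  have := colon_prime_height memI D_up P_prime Pf P_height.
  set A := [set i | _] => le_hA.
  (* If A is empty then h = 0 and m = 1, and the bound is n. *)
  have [A0 | A0] := eqVneq A set0.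
    have -> : m./2 = 0%N by move: le_hA; rewrite A0 cards0; lia.
    by rewrite subn0; apply: sdepth_dec_le_nvars.
  have le_m : (n - #|A|./2 <= n - m./2)%N by lia.
  apply: leq_trans (sdepth_dec_le_local memI dec A0 _ D_up) le_m => N.
  have [a [aD aND]] := colon_prime_monom memI P_prime Pf N.
  exists a; split=> [i | ]; first by rewrite inE; apply: aD.
  suff -> : [multinom if i \in A then 0 else N | i < n]%N =
      [multinom if 'X_i \in P then 0 else N | i < n]%N by [].
  by apply/mnmP => i; rewrite !mnmE inE.
split=> //.
have size_G : size G = m by [].
pose g (j : 'I_m) := nth 0%MM G j.
have [L dimL cntL] := generators_partition g m_odd.
have D_g w : [exists j, (g j <= w)%MM] = D w.
  apply/existsP/hasP => [[j gj] | [v vG vw]].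
    by exists (g j); rewrite // mem_nth // size_G.
  have lt_v : (index v G < m)%N by rewrite -size_G index_mem.
  by exists (Ordinal lt_v); rewrite /g /= nth_index.
have {}cntL w : count (in_cone^~ w) L = D w by rewrite cntL D_g.
have decL := cones_stanley_decomposition memI cntL.
do 3!eexists; split; first exact: decL.
apply/eqP; rewrite eqn_leq (upper _ _ _ decL) sdepth_dec_ge ?leq_subr // => i.
by have /allP := dimL; apply; rewrite mem_tnth.
Qed.
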